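(* Let $(T_n)_{n\ge 0}$ be the Tribonacci sequence. The Diophantine equation $$(T_{n}-1)(T_{n+1}-1)\cdots (T_{n+\ell-1}-1)=d\left(\frac{10^{m}-1}{9}\right)$$ has no solution in positive integers $n,\ell,m,d$ with $1\leq d\leq 9$ and $m\geq 2$.
   Context: The Tribonacci sequence is defined by $T_0=0$, $T_1=T_2=1$ and $T_{n+3}=T_{n+2}+T_{n+1}+T_n$ for all $n\ge 0$. The right-hand side $d(10^m-1)/9$ is the repdigit consisting of $m$ copies of the digit $d$. *)

(* Defs.v *)
From HB Require Import structures.
From mathcomp Require Import all_boot all_order all_algebra.

Set Implicit Arguments.
Unset Strict Implicit.
Unset Printing Implicit Defensive.

Fixpoint tribonacci (n : nat) : nat :=
  match n with
  | 0 => 0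
  | 1 => 1
  | 2 => 1
  | ((k.+1 as k1).+1 as k2).+1 => tribonacci k2 + tribonacci k1 + tribonacci k
  end.

(* Main.v *)
(** Write [u_k = T_{k+1} - 1] and let [P] be the product, so that the equation
    becomes [9 P + d = d * 10 ^ m].  Eight consecutive [u]'s have a product
    divisible by 16, whereas [16] does not divide [d (10 ^ m - 1)]; hence
    [l <= 7].  If [m <= 4], the first factor is below [10 ^ 4], leaving
    finitely many cases.  If [m >= 5], then [9 P + d] vanishes modulo 800, which
    selects few triples [(k mod 9920, l, d)].  Each of them is refuted modulo
    [7 * 44641]: the prime 44641 combines a short period of the Tribonacci
    sequence, [89280 = 9 * 9920], with a small order of 10, namely 186. *)
From Stdlib Require Import NArith.
Require Import Defs.
From mathcomp Require Import all_boot all_order all_algebra.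
From mathcomp Require Import zify.
Import Order.TTheory GRing.Theory Num.Theory.

(** * The sequence [T - 1] *)

(** Starting at [T_1] makes every term positive, so the truncated predecessor is the true
    [T_{k+1} - 1]. *)
Definition trib1 (k : nat) : nat := (tribonacci k.+1).-1.

Definition trib1_prod (k l : nat) : nat := \prod_(i < l) trib1 (k + i).

Lemma tribonacciS3 n :
  tribonacci n.+3 = tribonacci n.+2 + tribonacci n.+1 + tribonacci n.
Proof. by []. Qed.

Lemma tribonacci_gt0 n : 0 < tribonacci n.+1.
Proof.
elim: n {-2}n (leqnn n) => [|N IH] [|[|n]] // Hn.
by rewrite tribonacciS3 -addnA ltn_addr // IH // ltnW.
Qed.

Lemma trib1S3 k : trib1 k.+3 = trib1 k + trib1 k.+1 + trib1 k.+2 + 2.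
Proof.
rewrite /trib1 tribonacciS3.
move: (tribonacci_gt0 k) (tribonacci_gt0 k.+1) (tribonacci_gt0 k.+2); lia.
Qed.

Lemma trib1_leq : {homo trib1 : j k / j <= k}.
Proof.
apply: homo_leq => [//|j i k|[|[|k]]] //; first exact: leq_trans.
rewrite trib1S3; lia.
Qed.

Lemma trib1_gt0 k : 1 < k -> 0 < trib1 k.
Proof. exact: (@trib1_leq 2). Qed.

Lemma trib1_prodD k l r :
  trib1_prod k (l + r) = trib1_prod k l * trib1_prod (k + l) r.
Proof.
rewrite /trib1_prod big_split_ord; congr (_ * _).
by apply: eq_bigr => i _; rewrite /= addnA.
Qed.

Lemma trib1_prodSr k l : trib1_prod k l.+1 = trib1_prod k l * trib1 (k + l).
Proof. by rewrite /trib1_prod big_ord_recr. Qed.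

Lemma trib1_prodSl k l : trib1_prod k l.+1 = trib1 k * trib1_prod k.+1 l.
Proof.
rewrite /trib1_prod big_ord_recl addn0; congr (_ * _).
by apply: eq_bigr => i _; rewrite /= addnS addSn.
Qed.

(** * Residues in binary arithmetic *)

(** Computations run on binary [x], proofs on unary [y]; [x] need not be the least residue. *)
Definition residue (q x : N) (y : nat) : Prop :=
  N.to_nat x = y %[mod N.to_nat q].

Lemma to_natD x y : N.to_nat (x + y)%num = N.to_nat x + N.to_nat y.
Proof. exact: N2Nat.inj_add. Qed.

Lemma to_natM x y : N.to_nat (x * y)%num = N.to_nat x * N.to_nat y.
Proof. exact: N2Nat.inj_mul. Qed.

Lemma to_nat_modE x q : N.to_nat (x mod q)%num = N.to_nat x %% N.to_nat q.
Proof.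
have [->|q0] := N.eq_dec q 0; first by rewrite N.mod_0_r modn0.
rewrite {2}(N.div_mod x q q0) to_natD to_natM mulnC modnMDl.
by rewrite modn_small //; have := N.mod_lt x q q0; lia.
Qed.

Lemma residue_mod q x y : residue q x y -> residue q (x mod q)%num y.
Proof. by rewrite /residue to_nat_modE modn_mod. Qed.

Lemma residueD q x x' y y' :
  residue q x y -> residue q x' y' -> residue q (x + x')%num (y + y').
Proof. by rewrite /residue to_natD -modnDm => -> ->; rewrite modnDm. Qed.

Lemma residueM q x x' y y' :
  residue q x y -> residue q x' y' -> residue q (x * x')%num (y * y').
Proof. by rewrite /residue to_natM -modnMm => -> ->; rewrite modnMm. Qed.

Lemma residue_to_nat q x : residue q x (N.to_nat x).
Proof. by []. Qed.

Lemma residue_of_nat q y : residue q (N.of_nat y) y.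
Proof. by rewrite /residue Nat2N.id. Qed.

Lemma residue_mod_eq q x x' y y' : residue q x y -> residue q x' y' ->
  y = y' %[mod N.to_nat q] -> (x mod q = x' mod q)%num.
Proof.
move=> Hx Hx' E; apply: N2Nat.inj.
by rewrite !to_nat_modE Hx Hx'.
Qed.

Definition reduce (q x : N) : N := if (q <=? x)%num then (x - q)%num else x.

Lemma residue_reduce q x y : residue q x y -> residue q (reduce q x) y.
Proof.
rewrite /reduce /residue; case: N.leb_spec => // le_qx <-.
have {2}-> : x = (x - q + q)%num by lia.
by rewrite to_natD modnDr.
Qed.

(** Entries below [q] give a sum of at most [3q - 1], so two conditional subtractions reach the
    least residue. States then recur literally, and a period can be tested as an equality of
    states. *)
Definition step (q : N) (s : N * N * N) : N * N * N :=
  let: (a, b, c) := s in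
  (b, c, reduce q (reduce q (a + b + c + 2)%num)).

Definition state (q : N) (k : nat) : N * N * N :=
  iter k (step q) (0%num, 0%num, 1%num).

Lemma state_residues q k :
  [/\ residue q (state q k).1.1 (trib1 k),
      residue q (state q k).1.2 (trib1 k.+1)
    & residue q (state q k).2 (trib1 k.+2)].
Proof.
elim: k => [//|k]; rewrite /state iterS -/(state q k).
case: (state q k) => [[a b] c] /= [Ha Hb Hc]; split=> //.
rewrite trib1S3; do 2 apply: residue_reduce.
by do 3?apply: residueD.
Qed.

Fixpoint window_prod (q : N) (l : nat) (s : N * N * N) : N :=
  if l is l'.+1 then ((s.1.1 * window_prod q l' (step q s)) mod q)%num
  else 1%num.

Lemma window_prod_residue q k l :
  residue q (window_prod q l (state q k)) (trib1_prod k l).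
Proof.
elim: l k => [|l IH] k; first by rewrite /trib1_prod big_ord0.
rewrite trib1_prodSl; apply: residue_mod; apply: residueM; last exact: (IH k.+1).
by case: (state_residues q k).
Qed.

Lemma iter_modn (T : Type) (f : T -> T) (x : T) (N k : nat) :
  iter N f x = x -> iter (k %% N) f x = iter k f x.
Proof.
move=> fN; rewrite {2}(divn_eq k N) addnC iterD; congr (iter _ f _).
by elim: (k %/ N) => //= j IH; rewrite mulSn iterD -IH fN.
Qed.

(** * The sieve *)

(* The residue of [9 P] modulo 800 determines the only [d] in [1..800] with
   [9 P + d] divisible by 800. *)
Fixpoint candidates (k l : nat) (p : N) (s : N * N * N) : seq (nat * nat) :=
  if k is k'.+1 then
    let p' := ((p * s.1.1) mod 800)%num in
    let d := (800 - (9 * p') mod 800)%num in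
    let r := candidates k' l.+1 p' (step 800 s) in
    if (d <=? 9)%num then (l.+1, N.to_nat d) :: r else r
  else [::].

Lemma candidatesS k l p s : candidates k.+1 l p s =
  let p' := ((p * s.1.1) mod 800)%num in
  let d := (800 - (9 * p') mod 800)%num in
  let r := candidates k l.+1 p' (step 800 s) in
  if (d <=? 9)%num then (l.+1, N.to_nat d) :: r else r.
Proof. by []. Qed.

(** Invariant of the scan: [p] carries the product of the [l] terms already read, the state stands
    at [k + l], and [j] more window lengths remain to be tried. *)
Lemma mem_candidates j k l p r d : residue 800 p (trib1_prod k l) ->
  l < r <= l + j -> 1 <= d <= 9 -> 800 %| 9 * trib1_prod k r + d ->
  (r, d) \in candidates j l p (state 800 (k + l)).
Proof.
elim: j l p => [|j IH] l p Hp Hr Hd Hdvd; first lia.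
rewrite candidatesS.
have [Hs _ _] := state_residues 800 (k + l).
have := residue_mod _ _ _ (residueM _ _ _ _ _ Hp Hs); rewrite -trib1_prodSr.
move: ((p * _) mod 800)%num => p' Hp'; cbv zeta.
have {}IH : l.+1 < r -> (r, d) \in candidates j l.+1 p' (step 800 (state 800 (k + l))).
  move=> lt_lr; rewrite -[step _ _]/(state 800 (k + l).+1) -addnS.
  by apply: IH => //; lia.
have [eq_rl|ne_rl] := eqVneq r l.+1; last first.
  have {}IH := IH ltac:(lia).
  by case: ifP => // _; rewrite inE IH orbT.
have Hdvd' : 800 %| 9 * N.to_nat p' + d.
  move: Hdvd; rewrite eq_rl; move: Hp'; rewrite /residue.
  set y := trib1_prod _ _; change (N.to_nat 800) with 800; lia.
have Ed : (800 - (9 * p') mod 800)%num = N.of_nat d.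
  have := to_nat_modE (9 * p') 800; rewrite to_natM.
  move: ((9 * p') mod 800)%num => t; move: Hdvd'.
  rewrite /dvdn; change (N.to_nat 800) with 800; change (N.to_nat 9) with 9; lia.
rewrite Ed; case: N.leb_spec => [_|]; last lia.
by rewrite Nat2N.id inE eq_rl eqxx.
Qed.

(* [Q = 7 * 44641]; [trib1] has period 89280 and [10] has order 186
   modulo [Q]. *)
Definition Q : N := 312487%num.

(** The row for [d = 0] is there only so that row [d] sits at index [d]. *)
Definition repdigit_residues (js : seq nat) : seq (seq N) :=
  [seq [seq ((N.of_nat d * 10 ^ N.of_nat j) mod Q)%num | j <- js]
     | d <- iota 0 10].

(** The table [ts] is an argument so that one evaluation serves the whole sieve. *)
Definition excluded (ts : seq (seq N)) (s : N * N * N) (c : nat * nat) : bool :=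
  let v := ((9 * window_prod Q c.1 s + N.of_nat c.2) mod Q)%num in
  all (fun w => ~~ (v =? w)%num) (nth [::] ts c.2).

(** An equality would survive modulo [Q] and put the left side in row [d]. Beyond [d = 9] the lookup
    yields the empty row and the test is vacuous, hence the bound. *)
Lemma excludedP js k l d j m :
  excluded (repdigit_residues js) (state Q k) (l, d) -> d <= 9 -> j \in js ->
  10 ^ m = 10 ^ j %[mod N.to_nat Q] ->
  9 * trib1_prod k l + d <> d * 10 ^ m.
Proof.
rewrite /excluded /= => /allP Hex Hd Hj Hm E.
have : ((N.of_nat d * 10 ^ N.of_nat j) mod Q)%num
         \in nth [::] (repdigit_residues js) d.
  rewrite (nth_map 0) ?size_iota // nth_iota // add0n.
  exact: (map_f (fun j => ((N.of_nat d * 10 ^ N.of_nat j) mod Q)%num)).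
move/Hex/negP; apply; apply/N.eqb_spec.
have Rl := residueD _ _ _ _ _ (residueM _ _ _ _ _ (residue_to_nat Q 9)
  (window_prod_residue Q k l)) (residue_of_nat Q d).
have Rr : residue Q (N.of_nat d * 10 ^ N.of_nat j)%num (d * 10 ^ m).
  apply: residueM; first exact: residue_of_nat.
  rewrite /residue Hm; congr (_ %% _).
  elim: (j) => // i IH.
  by rewrite Nat2N.inj_succ N.pow_succ_r' to_natM IH expnS.
by apply: (residue_mod_eq _ _ _ _ _ Rl Rr); rewrite E.
Qed.

Fixpoint sieve (ts : seq (seq N)) (cs : seq (seq (nat * nat)))
    (s : N * N * N) : bool :=
  if cs is c :: cs' then all (excluded ts s) c && sieve ts cs' (step Q s)
  else true.

Lemma sieveP ts cs s i c : sieve ts cs s -> c \in nth [::] cs i ->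
  excluded ts (iter i (step Q) s) c.
Proof.
elim: cs i s => [|c' cs IH] [|i] s //= /andP[/allP Hc Hcs]; first exact: Hc.
by rewrite -iterS iterSr; exact: IH.
Qed.

Lemma nth_flatten_nseq (T : Type) (x0 : T) (r : seq T) k i :
  i < k * size r -> nth x0 (flatten (nseq k r)) i = nth x0 r (i %% size r).
Proof.
elim: k i => [//|k IH] i Hi /=; rewrite nth_cat; case: ltnP => [lt_ir|le_ri].
  by rewrite modn_small.
rewrite IH; last by rewrite ltn_subLR // -mulSn.
by rewrite -{2}(subnK le_ri) modnDr.
Qed.

Definition candidate_cycle (N : nat) : seq (seq (nat * nat)) :=
  [seq candidates 7 0 1%num s | s <- traject (step 800) (state 800 0) N].

(** The index [k] may be reduced modulo [K * N], a period modulo [Q]. The candidates depend only on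
    [k] modulo [N], so [K] copies of one cycle line up with the states modulo [Q]. *)
Lemma sieve_excludes (N K : nat) (ts : seq (seq _)) k l d :
  0 < N -> 0 < K -> state 800 N = state 800 0 -> state Q (K * N) = state Q 0 ->
  sieve ts (flatten (nseq K (candidate_cycle N))) (state Q 0) ->
  0 < l <= 7 -> 1 <= d <= 9 -> 800 %| 9 * trib1_prod k l + d ->
  excluded ts (state Q k) (l, d).
Proof.
move=> N0 K0 per800 perQ Hsieve Hl Hd Hdvd.
rewrite -[state Q k](@iter_modn _ _ _ (K * N)) //.
apply: sieveP Hsieve _.
have size_cycle : size (candidate_cycle N) = N by rewrite size_map size_traject.
rewrite nth_flatten_nseq size_cycle ?ltn_pmod ?muln_gt0 ?K0 //.
rewrite modn_dvdm ?dvdn_mull // (nth_map (state 800 0)) ?size_traject ?ltn_pmod //.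
rewrite nth_traject ?ltn_pmod // iter_modn //.
have := @mem_candidates 7 k 0 1%num l d; rewrite addn0; apply => //.
by rewrite /trib1_prod big_ord0.
Qed.

(** Here [800 = 32 * 25], with periods 64 modulo 32 and 155 modulo 25. *)
Lemma state800_period : state 800 (64 * 155) = state 800 0.
Proof. by vm_compute. Qed.

Lemma stateQ_period : state Q (9 * (64 * 155)) = state Q 0.
Proof. by vm_compute. Qed.

Lemma sieve_period :
  sieve (repdigit_residues (iota 0 186))
    (flatten (nseq 9 (candidate_cycle (64 * 155)))) (state Q 0).
Proof. by vm_compute. Qed.

Lemma expn_mod_order a n q m : a ^ n = 1 %[mod q] ->
  a ^ m = a ^ (m %% n) %[mod q].
Proof.
move=> Ha; rewrite {1}(divn_eq m n) expnD (mulnC (m %/ n)) expnM.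
by rewrite -modnMml -modnXm Ha modnXm exp1n modnMml mul1n.
Qed.

Lemma expn10_modQ m : 10 ^ m = 10 ^ (m %% 186) %[mod N.to_nat Q].
Proof.
apply: expn_mod_order.
(* The power is moved to binary before its residue is computed; in unary it is out of reach. *)
have {1}-> : 10 ^ 186 = N.to_nat (10 ^ 186)%num by lia.
by rewrite -to_nat_modE.
Qed.

(** * Repdigits *)

Lemma large_repdigit_excluded k l m d : 0 < l <= 7 -> 1 <= d <= 9 -> 5 <= m ->
  9 * trib1_prod k l + d <> d * 10 ^ m.
Proof.
move=> Hl Hd Hm E.
apply: (excludedP (iota 0 186) k l d (m %% 186) m _ _ _ _ E).
- apply: (sieve_excludes _ _ _ _ _ _ _ _
    state800_period stateQ_period sieve_period Hl Hd) => //.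
  (* From [5 <= m], the number [10 ^ m] is a multiple of [10 ^ 5 = 800 * 125]. *)
  by rewrite E dvdn_mull // -(subnKC Hm) expnD dvdn_mulr.
- by case/andP: Hd.
- by rewrite mem_iota ltn_pmod.
- exact: expn10_modQ.
Qed.

Lemma small_states_excluded :
  all (fun s => all (excluded (repdigit_residues [:: 2; 3; 4]) s)
                  [seq (l, d) | l <- iota 1 7, d <- iota 1 9])
    [seq state Q k | k <- iota 2 14].
Proof. by vm_compute. Qed.

Lemma small_repdigit_excluded k l m d : 0 < l <= 7 -> 1 <= d <= 9 ->
  2 <= m <= 4 -> 9 * trib1_prod k l + d <> d * 10 ^ m.
Proof.
move=> Hl Hd Hm E.
have P_gt0 : 0 < trib1_prod k l.
  have : 10 ^ 1 <= 10 ^ m by rewrite leq_exp2l //; lia.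
  nia.
have P_lt : trib1_prod k l < 10 ^ 4.
  have : 10 ^ m <= 10 ^ 4 by rewrite leq_exp2l //; lia.
  nia.
have dvd_kP : trib1 k %| trib1_prod k l.
  by case: l Hl {E P_gt0 P_lt} => // l _; rewrite trib1_prodSl dvdn_mulr.
(* The first factor is zero for [k = 0] and [k = 1]. *)
have k_gt1 : 1 < k.
  by case: k dvd_kP P_gt0 {E P_lt} => [|[|k]] //; rewrite dvd0n; lia.
(* The cutoff is [trib1 16 = 10608], which exceeds [10 ^ 4]. *)
have k_lt16 : k < 16.
  rewrite ltnNge; apply/negP => /trib1_leq le16.
  have := leq_ltn_trans (leq_trans le16 (dvdn_leq P_gt0 dvd_kP)) P_lt.
  by vm_compute.
apply: (excludedP [:: 2; 3; 4] k l d m m _ _ _ _ E) => //.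
- have k_in : k \in iota 2 14 by rewrite mem_iota; lia.
  have /allP/(_ _ (map_f (state Q) k_in))/allP := small_states_excluded.
  by apply; apply/allpairsP; exists (l, d); rewrite !mem_iota; split=> //=; lia.
- by case/andP: Hd.
- by rewrite !inE; lia.
Qed.

(** States modulo 16 have period 32, so 32 starting points decide the claim. *)
Lemma dvdn16_trib1_prod8 k : 16 %| trib1_prod k 8.
Proof.
have := window_prod_residue 16 k 8.
have <- : state 16 (k %% 32) = state 16 k by apply: iter_modn; vm_compute.
have /allP H : all (fun k => window_prod 16 8 (state 16 k) == 0%num) (iota 0 32).
  by vm_compute.
have /H/eqP -> : k %% 32 \in iota 0 32 by rewrite mem_iota ltn_pmod.
by rewrite /residue mod0n => E; apply/eqP; rewrite -E.
Qed.

Lemma long_repdigit_excluded k l m d : 8 <= l -> 1 <= d <= 9 -> 0 < m ->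
  9 * trib1_prod k l + d <> d * 10 ^ m.
Proof.
case: m => // m Hl Hd _ E.
have : 16 %| d * (10 ^ m.+1 - 1).
  rewrite mulnBr muln1 -E addnK dvdn_mull // -(subnKC Hl) trib1_prodD.
  by rewrite dvdn_mulr ?dvdn16_trib1_prod8.
(* Since [10 ^ m.+1 - 1] is odd, 16 would have to divide [d], which lies between 1 and 9. *)
rewrite Gauss_dvdl; first by move/dvdn_leq; lia.
rewrite (@coprime_pexpl 4 2) // coprime2n oddB ?expn_gt0 //.
by rewrite expnS oddM.
Qed.

(** * Transfer from the integers to the natural numbers *)

Local Open Scope ring_scope.

(** The division is exact: [10 - 1] divides [10 ^+ m - 1]. *)
Lemma mulz_repunit m : 9 * ((10 ^+ m - 1) %/ 9)%Z = 10 ^+ m - 1 :> int.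
Proof. by rewrite mulrC divzK // subrX1 dvdz_mulr. Qed.

Lemma trib1_prodz n l : (0 < n)%N ->
  (trib1_prod n.-1 l)%:Z = \prod_(i < l) ((tribonacci (n + i))%:Z - 1).
Proof.
case: n => // n _; rewrite (big_morph Posz PoszM (erefl _)).
apply: eq_bigr => i _; rewrite addSn -[n.+1.-1]/n /trib1.
by have := tribonacci_gt0 (n + i); lia.
Qed.

Theorem theorem2 :
  ~ exists n l m d : nat,
      [/\ (1 <= n)%N, (1 <= l)%N, (2 <= m)%N, (1 <= d <= 9)%N &
          \prod_(i < l) ((tribonacci (n + i))%:Z - 1) =
            d%:Z * ((10 ^+ m - 1) %/ 9)%Z].
Proof.
case=> [n [l [m [d [Hn Hl Hm Hd E]]]]].
(* Multiplying by 9 clears the quotient, and moving [d] to the left avoids subtraction in [nat]. *)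
have {}E : (9 * trib1_prod n.-1 l + d = d * 10 ^ m)%N.
  apply/eqP; rewrite -eqz_nat PoszD !PoszM trib1_prodz // E mulrCA mulz_repunit.
  by rewrite mulrBr mulr1 subrK -!natz natrX.
have [l_le7|l_gt7] := leqP l 7; last first.
  by apply: long_repdigit_excluded E => //; apply: ltnW.
have [m_le4|m_gt4] := leqP m 4.
  by apply: small_repdigit_excluded E; rewrite ?Hl ?Hm.
by apply: large_repdigit_excluded E; rewrite ?Hl.
Qed.
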